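(* Let $K$ be an algebraically closed field of characteristic zero, and let $f:K[x,y]\to K[x,y]$ be a $K$-algebra endomorphism such that $\mathrm{Jac}(f(x),f(y))\in K^*$. Put $P=f(x)$, $Q=f(y)$, and let $K[P,Q][x+y]$ be the $K$-subalgebra of $K[x,y]$ generated by $P,Q,x+y$. If $K[P,Q][x+y]$ is a regular ring, then $f$ is invertible.
   Context: A commutative ring is regular if it is Noetherian and its localization at every prime ideal is a regular local ring. *)

(* Defs.v *)
From HB Require Import structures.
From mathcomp Require Import all_boot all_order all_algebra.
From mathcomp Require Import mpoly.
Set Implicit Arguments. Unset Strict Implicit. Unset Printing Implicit Defensive.
Import Order.TTheory GRing.Theory Num.Theory.
Local Open Scope ring_scope.

(* Elementary commutative algebra for a subring A of a commutative     *)
(* ring R, A being given as a (Prop-valued) membership predicate.       *)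
Section SubringAlgebra.
Variable R : comRingType.
Variable A : R -> Prop.

Definition ideal_of (I : R -> Prop) : Prop :=
  [/\ (forall x, I x -> A x), I 0,
      (forall x y, I x -> I y -> I (x + y)) &
      (forall a x, A a -> I x -> I (a * x))].

Definition proper_ideal (I : R -> Prop) : Prop :=
  ideal_of I /\ exists x, A x /\ ~ I x.

Definition prime_ideal (I : R -> Prop) : Prop :=
  proper_ideal I /\
  forall a b, A a -> A b -> I (a * b) -> I a \/ I b.

Definition maximal_ideal (I : R -> Prop) : Prop :=
  proper_ideal I /\
  forall J, proper_ideal J -> (forall x, I x -> J x) -> forall x, J x <-> I x.

Definition ideal_generated_by (I : R -> Prop) (n : nat) (g : 'I_n -> R) : Prop :=
  (forall i, A (g i)) /\
  forall x, I x <-> exists c : 'I_n -> R, (forall i, A (c i)) /\ x = \sum_i c i * g i.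

Definition finitely_generated (I : R -> Prop) : Prop :=
  exists n (g : 'I_n -> R), ideal_generated_by I g.

Definition noetherian : Prop :=
  forall I, ideal_of I -> finitely_generated I.

Definition prime_chain (d : nat) (c : nat -> R -> Prop) : Prop :=
  (forall i, (i <= d)%N -> prime_ideal (c i)) /\
  (forall i, (i < d)%N ->
     (forall x, c i x -> c i.+1 x) /\ exists x, c i.+1 x /\ ~ c i x).

Definition krull_dim (d : nat) : Prop :=
  (exists c, prime_chain d c) /\ (forall e c, prime_chain e c -> (e <= d)%N).

Definition min_num_generators (I : R -> Prop) (n : nat) : Prop :=
  (exists g : 'I_n -> R, ideal_generated_by I g) /\
  (forall k (g : 'I_k -> R), ideal_generated_by I g -> (n <= k)%N).

Definition local_with (m : R -> Prop) : Prop :=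
  maximal_ideal m /\
  forall m', maximal_ideal m' -> forall x, m' x <-> m x.

Definition regular_local_ring : Prop :=
  noetherian /\
  exists m, local_with m /\ exists d, krull_dim d /\ min_num_generators m d.

End SubringAlgebra.

(* Localization of a subring S of an integral domain R at a prime ideal p
   of S, realized (canonically, since S is a domain) as the subring
   { a / s | a, s in S, s not in p } of the fraction field of R. *)
Definition localization (R : idomainType) (S : R -> Prop) (p : R -> Prop)
  : {fraction R} -> Prop :=
  fun z => exists a s, [/\ S a, S s, ~ p s & z = tofrac a / tofrac s].

Definition regular_ring (R : idomainType) (S : R -> Prop) : Prop :=
  noetherian S /\
  forall p, prime_ideal S p -> regular_local_ring (localization S p).

(* Two-variable polynomials: x = 'X_X0, y = 'X_X1 in {mpoly K[2]}.      *)
Definition X0 : 'I_2 := @Ordinal 2 0 isT.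
Definition X1 : 'I_2 := @Ordinal 2 1 isT.

Definition jac2 (K : comRingType) (P Q : {mpoly K[2]}) : {mpoly K[2]} :=
  mderiv X0 P * mderiv X1 Q - mderiv X1 P * mderiv X0 Q.

Definition endo2 (K : comRingType) (P Q : {mpoly K[2]}) :
  {mpoly K[2]} -> {mpoly K[2]} :=
  fun h => h \mPo [tuple P; Q].

Definition subalg_PQxy (K : comRingType) (P Q : {mpoly K[2]}) :
  {mpoly K[2]} -> Prop :=
  fun z => exists g : {mpoly K[3]}, z = g \mPo [tuple P; Q; 'X_X0 + 'X_X1].

(* Main.v *)
Require Import Defs.
From HB Require Import structures.
From mathcomp Require Import all_boot all_order all_algebra.
From mathcomp Require Import mpoly ring zify.
From Stdlib Require Import Classical.
Set Implicit Arguments. Unset Strict Implicit. Unset Printing Implicit Defensive.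
Import GRing.Theory.
Local Open Scope ring_scope.

(** For [z] in [K[x,y]] let [h(p,q,t)] generate the kernel of
    [K[p,q,t] -> K[P,Q,z]], which is principal because [K[p,q,t]] is factorial
    and [P, Q] are algebraically independent.  Differentiating [h(P,Q,z) = 0]
    and inverting the Jacobian matrix of [(P,Q)] shows that the whole gradient
    of [h] at [(P,Q,z)] is a multiple of [g = h_t(P,Q,z)].  If [K[P,Q,z]] is
    smooth at every point coming from the plane, then [g] has no zero, hence is
    a nonzero constant [e]; so [h] divides [h_t - e], which forces [h_t = e] for
    degree reasons, [h] is linear in [t], and [z] lies in [K[P,Q]].
    Regularity yields this smoothness for [z = x + y]: at a singular point the
    local ring has embedding dimension 3 but Krull dimension at most 2.  Once
    [x + y] is in [K[P,Q]], [K[P,Q,x] = K[x,y]] is visibly smooth, so the same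
    argument with [z = x] puts [x], and then [y], in [K[P,Q]]. *)

(** * Factoriality of polynomial rings *)

Section Divisibility.
Variable R : idomainType.
Implicit Types (a b c p u : R) (s : seq R).

Definition divides a b := exists c, b = c * a.

Definition prime_elt p :=
  [/\ p != 0, p \isn't a GRing.unit &
      forall a b, divides p (a * b) -> divides p a \/ divides p b].

Definition prime_factored a := exists u s,
  [/\ u \is a GRing.unit, {in s, forall p, prime_elt p} &
      a = u * \prod_(p <- s) p].

(** Factors are required to be prime, not merely irreducible, so uniqueness is built in. *)
Definition factorial_ring := forall a, a != 0 -> prime_factored a.

Lemma divides_mull a b c : divides a b -> divides a (c * b).
Proof. by case=> d ->; exists (c * d); rewrite mulrA. Qed.

Lemma divides_add a b c : divides a b -> divides a c -> divides a (b + c).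
Proof. by case=> d -> [e ->]; exists (d + e); rewrite mulrDl. Qed.

Lemma factorial_unit_or_prime a : factorial_ring -> a != 0 ->
  a \is a GRing.unit \/ exists2 p, prime_elt p & divides p a.
Proof.
move=> fR /fR[u [[|p s] [uu ps ->]]]; first by left; rewrite big_nil mulr1.
right; exists p; first by apply: ps; rewrite mem_head.
by exists (u * \prod_(j <- s) j); rewrite big_cons mulrCA mulrC.
Qed.

Lemma factorial_ind (T : R -> Prop) : factorial_ring ->
    (forall u, u \is a GRing.unit -> T u) ->
    (forall p a, prime_elt p -> a != 0 -> T a -> T (p * a)) ->
  forall a, a != 0 -> T a.
Proof.
move=> fR T0 T1 a /fR[u [s [uu ps ->]]].
have unz : u != 0 by apply: contraTneq uu => ->; rewrite unitr0.
elim: s ps => [_|p s IH ps]; first by rewrite big_nil mulr1; apply: T0.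
have pp := ps p (mem_head _ _).
have ps' q : q \in s -> prime_elt q by move=> qs; apply: ps; rewrite inE qs orbT.
rewrite big_cons mulrCA; apply: T1 => //; last exact: IH.
rewrite mulf_neq0 // prodf_seq_neq0; apply/allP => q /ps'.
by case=> ->.
Qed.

End Divisibility.

(** * Gauss's lemma and factoriality of [{poly R}] *)

Section FactorialPoly.
Variable R : idomainType.
Implicit Types (a b c p : R) (f g h d r : {poly R}).

Lemma divides_polyC_mulX p f : divides p%:P (f * 'X) -> divides p%:P f.
Proof.
case=> e; rewrite -[e](poly_take_drop 1) expr1 => he.
have /polyP/(_ 0%N) := he; rewrite coefMX coefMC coefD coefMX addr0 /= => h0.
have t0 : take_poly 1 e * p%:P = 0.
  apply/polyP=> -[|i]; rewrite coef0 coefMC; first by rewrite -h0.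
  by rewrite coef_take_poly mul0r.
exists (drop_poly 1 e); apply: (@mulIf _ 'X); first by rewrite polyX_eq0.
by rewrite he mulrDl t0 add0r mulrAC.
Qed.

(** Gauss's lemma, by induction on the sum of the sizes: [p] divides one of the two constant terms,
    and that factor can then lose its constant term and be divided by ['X]. *)
Lemma prime_polyC p : prime_elt p -> prime_elt p%:P.
Proof.
case=> pn0 pnu pp; split; rewrite ?polyC_eq0 //.
  by apply: contra pnu; rewrite poly_unitE coefC => /andP[].
move=> f g; have [n] := ubnP (size f + size g); elim: n f g => // n IH f g.
have step f1 g1 : (size f1 + size g1 < n.+1)%N ->
    divides p f1`_0 -> divides p%:P (f1 * g1) ->
    divides p%:P f1 \/ divides p%:P g1.
  move=> lt [e he] dfg; have [->|f1n0] := eqVneq f1 0.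
    by left; exists 0; rewrite mul0r.
  have ef : f1 = drop_poly 1 f1 * 'X + (e%:P * p%:P).
    rewrite -[LHS](poly_take_drop 1) expr1 addrC; congr (_ + _).
    apply/polyP=> -[|i]; rewrite -polyCM coef_take_poly coefC //=.
  have : divides p%:P (drop_poly 1 f1 * g1).
    apply: divides_polyC_mulX; rewrite mulrAC.
    have -> : drop_poly 1 f1 * 'X * g1 = f1 * g1 + (- (e%:P * g1)) * p%:P.
      by rewrite {2}ef; ring.
    by apply: divides_add => //; exists (- (e%:P * g1)).
  case/IH.
  - by rewrite size_drop_poly; move: f1n0 lt; rewrite -size_poly_gt0; lia.
  - by case=> k hk; left; rewrite ef hk; exists (k * 'X + e%:P); ring.
  - by right.
move=> lt dfg; case: (pp f`_0 g`_0).
- by case: dfg => k hk; exists k`_0; rewrite -coef0M hk coefMC.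
- by move=> /step; apply.
- move=> /(step g f); rewrite addnC mulrC => /(_ lt dfg); tauto.
Qed.

(** The prime factors of [c] are handed out one at a time: by Gauss's lemma each divides [d] or
    [r]. *)
Lemma polyC_mul_split c f d r : factorial_ring R -> c != 0 ->
  c%:P * f = d * r ->
  exists c1 c2 d' r', [/\ c = c1 * c2, d = c1%:P * d', r = c2%:P * r' & f = d' * r'].
Proof.
move=> fR cn0; move: c cn0 d r; apply: (factorial_ind fR) => [u uu|p c pp cn0 IH] d r.
  move=> e; exists u, 1, (u^-1%:P * d), r; rewrite mulr1 mul1r; split => //.
    by rewrite mulrA -polyCM divrr // mul1r.
  by rewrite -mulrA -e mulrA -polyCM mulVr // mul1r.
rewrite polyCM -mulrA => e.
have [pn0 _ pP] := prime_polyC pp.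
have : divides p%:P (d * r) by rewrite -e mulrC; exists (c%:P * f).
case/pP=> -[k hk].
  have /IH[c1 [c2 [d' [r' [-> ek -> ->]]]]] : c%:P * f = k * r.
    by apply: (mulfI pn0); rewrite e hk; ring.
  by exists (p * c1), c2, d', r'; split; rewrite ?hk ?ek ?polyCM //; ring.
have /IH[c1 [c2 [d' [r' [-> -> ek ->]]]]] : c%:P * f = d * k.
  by apply: (mulfI pn0); rewrite e hk; ring.
by exists c1, (p * c2), d', r'; split; rewrite ?hk ?ek ?polyCM //; ring.
Qed.

Lemma polyC_mul_cancel c f d r : factorial_ring R -> c != 0 -> d != 0 ->
  (forall p, prime_elt p -> ~ divides p%:P d) ->
  c%:P * f = d * r -> divides d f.
Proof.
move=> fR cn0 dn0 nd /(polyC_mul_split fR cn0)[c1 [c2 [d' [r' [ec ed er ->]]]]].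
have c1n0 : c1 != 0 by apply: contraNneq cn0 => c10; rewrite ec c10 mul0r.
have [uc1|[p pp [k hk]]] := factorial_unit_or_prime fR c1n0.
  exists (c1^-1%:P * r').
  by rewrite ed mulrACA -polyCM mulVr // mul1r mulrC.
by case: (nd p pp); exists (k%:P * d'); rewrite ed hk polyCM; ring.
Qed.

(* [d] is a nonzero element of least degree in the ideal [(f, g)]. *)
Lemma pseudo_gcd f g : f != 0 -> exists d u v c r s,
  [/\ d != 0, c != 0, d = u * f + v * g, c%:P * f = d * r & c%:P * g = d * s].
Proof.
move=> fn0; pose I d := exists u v, d = u * f + v * g.
have If : I f by exists 1, 0; ring.
have Ig : I g by exists 0, 1; ring.
have IM e d : I d -> I (e * d).
  by case=> u [v ->]; exists (e * u), (e * v); ring.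
have IB d e : I d -> I e -> I (d - e).
  by case=> u [v ->] [u' [v' ->]]; exists (u - u'), (v - v'); ring.
have [d [dn0 Id dmin]] : exists d, [/\ d != 0, I d &
    forall e, I e -> (size e < size d)%N -> e = 0].
  suff least n d : (size d < n)%N -> d != 0 -> I d -> exists d, [/\ d != 0, I d &
      forall e, I e -> (size e < size d)%N -> e = 0] by apply: (least _ f (leqnn _)).
  elim: n d => // n IH d lt dn0 Id.
  have [[e [Ie en0 lte]]|none] :=
    classic (exists e, [/\ I e, e != 0 & (size e < size d)%N]).
    by apply: (IH e) => //; apply: leq_trans lte lt.
  exists d; split=> // e Ie lte; apply/eqP/negPn/negP => en0.
  by apply: none; exists e.
(* Pseudo-division: the remainder of a multiple of [e] by [d] lies in the ideal and is shorter than
   [d], so it vanishes by minimality. *)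
have Idiv e : I e -> exists c r, c != 0 /\ c%:P * e = d * r.
  move=> Ie; exists (lead_coef d ^+ scalp e d), (e %/ d); split.
    by rewrite expf_neq0 ?lead_coef_eq0.
  have := Pdiv.Idomain.divp_eq e d; rewrite -mul_polyC => eq.
  have md0 : e %% d = 0.
    apply: dmin; last by rewrite ltn_modp.
    have -> : e %% d = (lead_coef d ^+ scalp e d)%:P * e - (e %/ d) * d.
      by rewrite eq addrC addKr.
    by apply: IB; apply: IM.
  by rewrite eq md0 addr0 mulrC.
have [c1 [r [c1n0 e1]]] := Idiv _ If.
have [c2 [s [c2n0 e2]]] := Idiv _ Ig.
case: Id => u [v ed]; exists d, u, v, (c1 * c2), (c2%:P * r), (c1%:P * s).
split=> //; first by rewrite mulf_neq0.
- by rewrite polyCM mulrAC e1; ring.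
- by rewrite polyCM -mulrA e2; ring.
Qed.

(** Elimination of the variable. A nonconstant [h] divides [d * r = c%:P * h], where [d] is a
    pseudo-gcd. It cannot divide [d], else it would divide [c%:P * g]; so it divides [r], and
    cancelling [h] puts [c] in the ideal. *)
Lemma prime_poly_resultant h g : prime_elt h -> ~ divides h g ->
  exists c u v, c != 0 /\ c%:P = u * h + v * g.
Proof.
case=> hn0 hnu hP ndvd.
have [d [u [v [c [r [s [dn0 cn0 ed eh eg]]]]]]] := pseudo_gcd g hn0.
case: (leqP (size h) 1) => [/size1_polyC eh0|sh].
  exists h`_0, 1, 0; rewrite -eh0 -polyC_eq0 -eh0; split=> //; ring.
have ndC e : e != 0 -> ~ divides h e%:P.
  move=> en0 [k hk]; have kn0 : k != 0.
    by apply: contraNneq en0 => k0; move: hk; rewrite k0 mul0r => /eqP; rewrite polyC_eq0.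
  have := congr1 (fun q : {poly R} => size q) hk.
  rewrite size_polyC en0 size_mul //; move: sh kn0; rewrite -size_poly_gt0 /=.
  by lia.
have [[k hk]|[k hk]] : divides h d \/ divides h r.
- by apply: hP; exists c%:P; rewrite eh.
- have : divides h (c%:P * g) by rewrite eg hk; exists (k * s); ring.
  by case/hP => // /(ndC _ cn0).
have dk : c%:P = d * k.
  by apply: (mulIf hn0); rewrite eh hk mulrA.
by exists c, (k * u), (k * v); split=> //; rewrite dk ed; ring.
Qed.

Lemma factorial_poly : factorial_ring R -> factorial_ring {poly R}.
Proof.
move=> fR.
(* Nonconstant irreducibles are prime: a pseudo-gcd of [f] and [a] yields [f = d' * r']. If [d'] is
   a unit, a nonzero constant lies in the ideal of [f] and [a], and [f] divides [b]; if [r'] is a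
   unit, [f] divides [a]. *)
have prime_irr f : f != 0 -> (1 < size f)%N ->
    (forall a b : {poly R}, f = a * b -> a \is a GRing.unit \/ b \is a GRing.unit) ->
    prime_elt f.
  move=> fn0 sf irr.
  have fnu : f \isn't a GRing.unit.
    by apply: contraL sf; rewrite poly_unitE => /andP[/eqP->].
  have nd p : prime_elt p -> ~ divides p%:P f.
    move=> /prime_polyC[_ pnu _] [k hk]; case: (irr _ _ hk) => [|/(negP pnu) //].
    rewrite poly_unitE => /andP[/eqP sk _]; move: sf; rewrite hk.
    have := size_polyMleq k p%:P; rewrite sk /=.
    by move=> /leq_trans/(_ (size_polyC_leq1 _)); rewrite leqNgt => /negP.
  split=> // a b [e he].
  have [d [u [v [c [r [s [dn0 cn0 ed ef ea]]]]]]] := pseudo_gcd a fn0.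
  have [c1 [c2 [d' [r' [ec ed' er' ef']]]]] := polyC_mul_split fR cn0 ef.
  have c1n0 : c1 != 0 by apply: contraNneq cn0 => c10; rewrite ec c10 mul0r.
  case: (irr _ _ ef') => [ud'|ur'].
    right; apply: (polyC_mul_cancel (r := (u * b + v * e) * d'^-1) fR c1n0 fn0 nd).
    have -> : c1%:P = d * d'^-1 by rewrite ed' mulrK.
    rewrite ed; have -> : (u * f + v * a) * d'^-1 * b
       = (u * f * b + v * (a * b)) * d'^-1 by ring.
    by rewrite he; ring.
  left; apply: (polyC_mul_cancel (r := c1%:P * r'^-1 * s) fR cn0 fn0 nd).
  rewrite ea ed' ef'.
  have -> : d' * r' * (c1%:P * r'^-1 * s) = d' * c1%:P * s * (r' * r'^-1) by ring.
  by rewrite divrr // mulr1; ring.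
(* Induction on degree: a nonunit factor of a primitive polynomial is nonconstant, so in a proper
   factorization both factors are shorter. *)
have primitive_case f : f != 0 ->
    (forall p, prime_elt p -> ~ divides p%:P f) ->
    prime_factored f.
  have unit_const g : g != 0 -> (forall p, prime_elt p -> ~ divides p%:P g) ->
      (size g <= 1)%N -> g \is a GRing.unit.
    move=> gn0 nd /size1_polyC eg; move: gn0; rewrite eg polyC_eq0 => gn0.
    case: (factorial_unit_or_prime fR gn0) => [|[p pp [k hk]]].
      by move=> ug; rewrite poly_unitE size_polyC gn0 coefC.
    by case: (nd p pp); exists k%:P; rewrite eg hk polyCM.
  have [n] := ubnP (size f); elim: n f => // n IH f lt fn0 nd.
  case: (leqP (size f) 1) => [sf|sf].
    exists f, [::]; split=> //; last by rewrite big_nil mulr1.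
    exact: unit_const.
  have [[a [b [ef anu bnu]]]|irr] := classic (exists a b : {poly R},
      [/\ f = a * b, a \isn't a GRing.unit & b \isn't a GRing.unit]); last first.
    exists 1, [:: f]; split; rewrite ?unitr1 ?big_seq1 ?mul1r //.
    move=> p; rewrite inE => /eqP->; apply: prime_irr => // a b ef.
    apply: NNPP => /not_or_and[/negP na /negP nb].
    by apply: irr; exists a, b.
  have [an0 bn0] : a != 0 /\ b != 0.
    by split; apply: contraNneq fn0 => e0; rewrite ef e0 ?mul0r ?mulr0.
  have nda p : prime_elt p -> ~ divides p%:P a.
    by move=> pp da; apply: (nd p pp); rewrite ef mulrC; apply: divides_mull.
  have ndb p : prime_elt p -> ~ divides p%:P b.
    by move=> pp db; apply: (nd p pp); rewrite ef; apply: divides_mull.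
  have sa : (1 < size a)%N by rewrite ltnNge; apply: contra anu; apply: unit_const.
  have sb : (1 < size b)%N by rewrite ltnNge; apply: contra bnu; apply: unit_const.
  have sab : size f = (size a + size b).-1 by rewrite ef size_mul.
  have [|u [s [uu ps ea]]] := IH a _ an0 nda; first by lia.
  have [|v [t [uv pt eb]]] := IH b _ bn0 ndb; first by lia.
  exists (u * v), (s ++ t); split; first by rewrite unitrM uu.
    by move=> p; rewrite mem_cat => /orP[/ps|/pt].
  by rewrite big_cat /= ef ea eb; ring.
(* [l] bounds the content of [f]; it starts as the leading coefficient, and induction on its prime
   factors pulls the constant primes out of [f]. *)
suff content_case l : l != 0 -> forall f, f != 0 ->
    (forall c, divides c%:P f -> divides c l) ->
    prime_factored f.
  move=> f fn0; apply: (content_case (lead_coef f)); rewrite ?lead_coef_eq0 //.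
  by move=> c [k ->]; exists (lead_coef k); rewrite lead_coefM lead_coefC.
move: l; apply: (factorial_ind fR) => [u uu|p a pp an0 IH] f fn0 cont.
  apply: primitive_case => // p [_ pnu _] /cont [k hk].
  by case/negP: pnu; move: uu; rewrite hk unitrM => /andP[].
have [pn0 pnu pP] := pp.
have [[k hk]|ndf] := classic (divides p%:P f).
  have kn0 : k != 0 by apply: contraNneq fn0 => k0; rewrite hk k0 mul0r.
  have [|u [s [uu ps ek]]] := IH k kn0.
    move=> c [e he]; have [|e' he'] := cont (p * c).
      by exists e; rewrite hk he polyCM; ring.
    by exists e'; apply: (mulfI pn0); rewrite he'; ring.
  exists u, (p%:P :: s); split=> //; last by rewrite big_cons hk ek; ring.
  by move=> q; rewrite inE => /orP[/eqP->|/ps //]; apply: prime_polyC.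
apply: IH => // c dcf; have [e he] := cont c dcf.
have [[k hk]|[k hk]] : divides p e \/ divides p c.
- by apply: pP; exists a; rewrite -he mulrC.
- by exists k; apply: (mulfI pn0); rewrite he hk; ring.
case: ndf; case: dcf => g ->; exists (g * k%:P).
by rewrite hk polyCM mulrA.
Qed.
End FactorialPoly.

(** * Multivariate polynomials *)

Lemma mpoly0_polyC (R : nzRingType) (p : {mpoly R[0]}) : p = (p@_0)%:MP.
Proof.
apply: msize1_polyC; rewrite msizeE; apply/bigmax_leqP_seq => m _ _.
by rewrite mdegE big_ord0.
Qed.

Section MPolyMorphisms.
Variables (n : nat) (R : comNzRingType).

Lemma mpoly_ring_ind (T : {mpoly R[n]} -> Prop) :
    (forall c, T c%:MP) -> (forall i, T 'X_i) ->
    (forall p q, T p -> T q -> T (p + q)) ->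
    (forall p q, T p -> T q -> T (p * q)) ->
  forall p, T p.
Proof.
move=> TC TX TD TM; elim/mpolyind=> [|c m p _ _ Tp]; first by rewrite -mpolyC0.
apply: TD => //; rewrite -mul_mpolyC; apply: (TM) => //.
rewrite mpolyXE_id; apply: (big_ind T) => [|a b|i _]; [by rewrite -mpolyC1|exact: TM|].
by elim: (m i) => [|k IH]; rewrite ?expr0 -?mpolyC1 // exprS; apply: TM.
Qed.

Lemma mpoly_rmorph_eq (S : nzRingType) (f g : {rmorphism {mpoly R[n]} -> S}) :
    (forall c, f c%:MP = g c%:MP) -> (forall i, f 'X_i = g 'X_i) -> f =1 g.
Proof.
move=> fgC fgX; apply: mpoly_ring_ind => // p q fgp fgq.
  by rewrite !rmorphD fgp fgq.
by rewrite !rmorphM fgp fgq.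
Qed.

Lemma comp_mpolyX_tnth k (lq : n.-tuple {mpoly R[k]}) i :
  'X_i \mPo lq = tnth lq i.
Proof. by rewrite comp_mpolyXU -tnth_nth. Qed.

Lemma comp_mpoly_comp k l (lq : n.-tuple {mpoly R[k]})
    (lr : k.-tuple {mpoly R[l]}) (p : {mpoly R[n]}) :
  (p \mPo lq) \mPo lr = p \mPo [tuple tnth lq i \mPo lr | i < n].
Proof.
elim/mpoly_ring_ind: p => [c|i|p q ep eq|p q ep eq].
- by rewrite !comp_mpolyC.
- by rewrite !comp_mpolyX_tnth tnth_mktuple.
- by rewrite !comp_mpolyD ep eq.
- by rewrite !rmorphM /= ep eq.
Qed.

Lemma mderivXU (i j : 'I_n) : ('X_i : {mpoly R[n]})^`M(j) = (i == j)%:R.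
Proof.
rewrite mderivX mnm1E; case: eqP => [->|_]; last by rewrite scale0r.
rewrite scale1r; have -> : (U_(j) - U_(j) = 0)%MM.
  by apply/mnmP=> l; rewrite mnmBE subnn mnm0E.
by rewrite mpolyX0.
Qed.

Lemma mderiv_comp_mpoly k (lq : n.-tuple {mpoly R[k]}) (p : {mpoly R[n]}) i :
  (p \mPo lq)^`M(i) = \sum_(j < n) (p^`M(j) \mPo lq) * (tnth lq j)^`M(i).
Proof.
elim/mpoly_ring_ind: p => [c|j|p q ep eq|p q ep eq].
- rewrite comp_mpolyC mderivC big1 // => j _.
  by rewrite mderivC comp_mpoly0 mul0r.
- rewrite comp_mpolyX_tnth (bigD1 j) //= big1 ?addr0.
    by rewrite mderivXU eqxx comp_mpoly1 mul1r.
  by move=> l lj; rewrite mderivXU eq_sym (negPf lj) comp_mpoly0 mul0r.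
- rewrite comp_mpolyD mderivD ep eq -big_split; apply: eq_bigr => j _ /=.
  by rewrite mderivD comp_mpolyD mulrDl.
- rewrite rmorphM mderivM ep eq mulr_suml mulr_sumr -big_split.
  apply: eq_bigr => j _ /=.
  by rewrite mderivM comp_mpolyD !rmorphM /=; ring.
Qed.

End MPolyMorphisms.

(** * Polynomials in [n.+1] variables as univariate polynomials in the last one *)

Section MPolyLast.
Variables (n : nat) (R : comNzRingType).
Local Notation widen := (widen_ord (leqnSn n)).

Lemma muniXm (m : 'X_{1..n.+1}) : muni ('X_[m] : {mpoly R[n.+1]}) =
  'X_[[multinom m (widen i) | i < n]] *: 'X^(m ord_max).
Proof. by rewrite muniE msuppX big_seq1 mcoeffX eqxx scale1r. Qed.

Lemma muniX_max : muni ('X_ord_max : {mpoly R[n.+1]}) = 'X.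
Proof.
rewrite muniXm mnm1E eqxx expr1; set m := [multinom _ | _ < _].
suff -> : m = 0%MM by rewrite mpolyX0 scale1r.
apply/mnmP=> i; rewrite mnmE mnm1E mnm0E.
by apply/eqP; rewrite eqb0 -val_eqE /= neq_ltn ltn_ord orbT.
Qed.

Lemma muniX_widen i : muni ('X_(widen i) : {mpoly R[n.+1]}) = ('X_i)%:P.
Proof.
rewrite muniXm mnm1E; set m := [multinom _ | _ < _].
have -> : m = U_(i)%MM.
  by apply/mnmP=> j; rewrite mnmE !mnm1E -!val_eqE.
rewrite -val_eqE /= ltn_eqF ?ltn_ord // expr0.
by rewrite -mul_polyC mulr1.
Qed.

Lemma ord_lastP (i : 'I_n.+1) : i = ord_max \/ exists j, i = widen j.
Proof.
case: (ltnP i n) => [lt|ge]; last first.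
  by left; apply: val_inj => /=; apply/eqP; rewrite eqn_leq ge -ltnS ltn_ord.
by right; exists (Ordinal lt); apply: val_inj.
Qed.

Definition mpoly_of_muni (p : {poly {mpoly R[n]}}) : {mpoly R[n.+1]} :=
  horner_morph (f := @mwiden n R) (u := 'X_ord_max) (fun x => mulrC _ _) p.

HB.instance Definition _ := GRing.RMorphism.copy mpoly_of_muni
  (horner_morph (f := @mwiden n R) (u := 'X_ord_max) (fun x => mulrC _ _)).

Lemma mwidenX_widen (i : 'I_n) : mwiden ('X_i : {mpoly R[n]}) = 'X_(widen i).
Proof. by rewrite mwidenX mnmwiden1. Qed.

Lemma mderiv_mwiden (p : {mpoly R[n]}) : (mwiden p)^`M(ord_max) = 0.
Proof.
elim/mpoly_ring_ind: p => [c|i|p q ep eq|p q ep eq].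
- by rewrite mwidenC mderivC.
- by rewrite mwidenX_widen mderivXU -val_eqE /= ltn_eqF.
- by rewrite mwidenD mderivD ep eq addr0.
- by rewrite mwidenM mderivM ep eq mul0r mulr0 addr0.
Qed.

Lemma mpoly_of_muniD : {morph mpoly_of_muni : p q / p + q}.
Proof. exact: rmorphD. Qed.

Lemma mpoly_of_muniM : {morph mpoly_of_muni : p q / p * q}.
Proof. exact: rmorphM. Qed.

Lemma mpoly_of_muniC c : mpoly_of_muni c%:P = mwiden c.
Proof. by rewrite /mpoly_of_muni horner_morphC. Qed.

Lemma mpoly_of_muniX : mpoly_of_muni 'X = 'X_ord_max.
Proof. by rewrite /mpoly_of_muni horner_morphX. Qed.

Lemma muniK : cancel (@muni n R) mpoly_of_muni.
Proof.
apply: (@mpoly_rmorph_eq _ _ _ (mpoly_of_muni \o @muni n R) idfun) => [c|i] /=.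
  by rewrite muniC mpoly_of_muniC mwidenC.
case: (ord_lastP i) => [->|[j ->]].
  by rewrite muniX_max mpoly_of_muniX.
by rewrite muniX_widen mpoly_of_muniC mwidenX_widen.
Qed.

Lemma muni_mwiden p : muni (mwiden p) = p%:P :> {poly {mpoly R[n]}}.
Proof.
apply: (@mpoly_rmorph_eq _ _ _ (@muni n R \o @mwiden n R) polyC) => [c|i] /=.
  by rewrite mwidenC muniC.
by rewrite mwidenX_widen muniX_widen.
Qed.

Lemma mpoly_of_muniK : cancel mpoly_of_muni (@muni n R).
Proof.
elim/poly_ind=> [|p c IH]; first by rewrite !rmorph0.
rewrite rmorphD rmorphM /= muniD muniM IH mpoly_of_muniX muniX_max.
by rewrite mpoly_of_muniC muni_mwiden.
Qed.

End MPolyLast.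

Lemma prime_elt_iso (R S : idomainType) (f : {rmorphism R -> S})
  (g : {rmorphism S -> R}) : cancel f g -> cancel g f ->
  forall p, prime_elt p -> prime_elt (f p).
Proof.
move=> fK gK p [pn0 pnu pP]; split.
- by apply: contraNneq pn0 => e; rewrite -(fK p) e rmorph0.
- by apply: contra pnu => /(rmorph_unit g); rewrite fK.
move=> a b [c /(congr1 g)]; rewrite !rmorphM fK => e.
case: (pP (g a) (g b)); first by exists (g c).
  by case=> d /(congr1 f); rewrite gK rmorphM => ->; left; exists (f d).
by case=> d /(congr1 f); rewrite gK rmorphM => ->; right; exists (f d).
Qed.

Lemma factorial_iso (R S : idomainType) (f : {rmorphism R -> S})
  (g : {rmorphism S -> R}) : cancel f g -> cancel g f ->
  factorial_ring R -> factorial_ring S.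
Proof.
move=> fK gK fR a an0.
have /fR[u [s [uu ps eu]]] : g a != 0.
  by apply: contraNneq an0 => e; rewrite -(gK a) e rmorph0.
exists (f u), [seq f p | p <- s]; split; first exact: rmorph_unit.
  by move=> _ /mapP[p /ps pp ->]; apply: (prime_elt_iso fK gK).
by rewrite -(gK a) eu rmorphM rmorph_prod big_map.
Qed.

Lemma factorial_mpoly (K : fieldType) n : factorial_ring {mpoly K[n]}.
Proof.
elim: n => [|n IH]; last first.
  have fP := @factorial_poly {mpoly K[n]} IH.
  exact: (@factorial_iso {poly {mpoly K[n]}} {mpoly K[n.+1]}
    (@mpoly_of_muni n K) (@muni n K) (@mpoly_of_muniK n K) (@muniK n K) fP).
move=> a an0; exists a, [::]; split=> //; last by rewrite big_nil mulr1.
move: an0; rewrite (mpoly0_polyC a) mpolyC_eq0 => an0.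
by apply: rmorph_unit; rewrite unitfE.
Qed.

(** [mwiden c] is free of the last variable; evaluated at [(P, Q, z)] it will give a relation
    between [P] and [Q] alone. *)
Lemma prime_mpoly_resultant (K : fieldType) n (h g : {mpoly K[n.+1]}) :
  prime_elt h -> ~ divides h g ->
  exists c u v, c != 0 /\ mwiden c = u * h + v * g.
Proof.
move=> hP nd.
have hP' := prime_elt_iso (@muniK n K) (@mpoly_of_muniK n K) hP.
have [|c [u [v [cn0 ec]]]] := prime_poly_resultant (g := muni g) hP'.
  case=> k hk; apply: nd; exists (mpoly_of_muni k).
  by rewrite -[h]muniK -mpoly_of_muniM -hk muniK.
exists c, (mpoly_of_muni u), (mpoly_of_muni v); split=> //.
rewrite -[h]muniK -[g]muniK -!mpoly_of_muniM -mpoly_of_muniD.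
by rewrite -ec mpoly_of_muniC.
Qed.

(** * Partial derivatives, degree and characteristic zero *)

Lemma msize_mderiv_lt (R : nzRingType) n (p : {mpoly R[n]}) i :
  p != 0 -> (msize p^`M(i) < msize p)%N.
Proof.
move=> pn0; rewrite [X in (_ < X)%N]mpolySpred // ltnS msizeE.
apply/bigmax_leqP_seq => m; rewrite mcoeff_msupp mcoeff_mderiv => mp _.
have : (m + U_(i))%MM \in msupp p.
  by rewrite mcoeff_msupp; apply: contraNneq mp => ->; rewrite mul0rn.
by move/msize_mdeg_lt; rewrite mdegD mdeg1; lia.
Qed.

Lemma mderiv_eq0_msupp (K : fieldType) n (p : {mpoly K[n]}) i :
  [pchar K] =i pred0 -> p^`M(i) = 0 -> forall m, m \in msupp p -> m i = 0%N.
Proof.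
move=> ch0 dp m; rewrite mcoeff_msupp => mp; apply/eqP; rewrite -leqn0 leqNgt.
apply/negP => mi; have lem : (U_(i) <= m)%MM by rewrite lep1mP -lt0n.
have /mpolyP/(_ (m - U_(i))%MM) := dp; rewrite mcoeff_mderiv submK // mcoeff0.
move/eqP; rewrite -mulr_natr mulf_eq0 (negPf mp) /=.
by rewrite ((pcharf0P _).1 ch0).
Qed.

Lemma mderiv_all_eq0 (K : fieldType) n (p : {mpoly K[n]}) :
  [pchar K] =i pred0 -> (forall i, p^`M(i) = 0) -> p = (p@_0)%:MP.
Proof.
move=> ch0 dp; apply: msize1_polyC; rewrite msizeE.
apply/bigmax_leqP_seq => m mp _; rewrite mdegE big1 // => i _.
exact: (mderiv_eq0_msupp ch0 (dp i)).
Qed.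

(** * Zeros of polynomials over an algebraically closed field *)

Section ClosedFieldMPoly.
Variable K : closedFieldType.

(** Induction on the variables: choose a point where the leading coefficient in the last variable is
    nonzero, then a nonroot of the resulting univariate polynomial. *)
Lemma mpoly_nonzeroP n (p : {mpoly K[n]}) : p != 0 -> exists v, p.@[v] != 0.
Proof.
elim: n p => [|n IH] p pn0.
  exists (fun => 0); apply: contraNneq pn0.
  by rewrite (mpoly0_polyC p) mevalC => ->; rewrite mpolyC0.
have /IH[w wn0] : lead_coef (muni p) != 0.
  rewrite lead_coef_eq0; apply: contraNneq pn0 => e.
  by rewrite -(muniK p) e rmorph0.
have /closed_nonrootP[x] : map_poly (meval w) (muni p) != 0.
  by rewrite -lead_coef_eq0 lead_coef_map_eq.
rewrite /root => nr; exists (fun i => if unlift ord_max i is Some j then w j else x).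
apply: contraNneq nr => <-; apply/eqP.
apply: (@mpoly_rmorph_eq _ _ _
  (horner_eval x \o map_poly (meval w) \o @muni n K) (meval _)) => [c|i] /=.
  by rewrite muniC map_polyC /= /horner_eval hornerC !mevalC.
rewrite mevalXU; case: (ord_lastP i) => [->|[j ->]].
  by rewrite muniX_max map_polyX /horner_eval hornerX unlift_none.
rewrite muniX_widen map_polyC /= /horner_eval hornerC mevalXU.
have -> : widen_ord (leqnSn n) j = lift ord_max j.
  by apply: ord_inj; rewrite lift_max.
by rewrite liftK.
Qed.

(** On the line joining the origin to any [v], the polynomial restricts to a univariate one without
    root, hence constant; so its values at [v] and at the origin agree. *)
Lemma mpoly_no_zero_const n (p : {mpoly K[n]}) :
  (forall v, p.@[v] != 0) -> exists2 c, c != 0 & p = c%:MP.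
Proof.
move=> pn0; exists p.@[fun => 0]; first exact: pn0.
apply/eqP; rewrite -subr_eq0; apply/negPn/negP => /mpoly_nonzeroP[v].
rewrite mevalB mevalC subr_eq0 => /negP; apply; apply/eqP.
pose l := mmap polyC (fun i => v i *: 'X) p.
have lE x : l.[x] = p.@[fun i => x * v i].
  apply: (@mpoly_rmorph_eq _ _ _
    (horner_eval x \o mmap polyC (fun i => v i *: 'X)) (meval _)) => [c|i] /=.
    by rewrite mmapC mevalC /horner_eval hornerC.
  by rewrite mmapX mmap1U mevalXU /horner_eval hornerZ hornerX mulrC.
have sl : size l = 1%N.
  apply/eqP/negPn/negP => /closed_rootP[x]; rewrite /root lE => /eqP e.
  by have := pn0 (fun i => x * v i); rewrite e eqxx.
have lC x : l.[x] = l`_0 by rewrite [l]size1_polyC ?sl // hornerC coefC.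
have <- : l.[1] = p.@[v] by rewrite lE; apply: meval_eq => i; rewrite mul1r.
have <- : l.[0] = p.@[fun => 0] by rewrite lE; apply: meval_eq => i; rewrite mul0r.
by rewrite !lC.
Qed.

End ClosedFieldMPoly.

(** * Algebraic dependence of [n.+1] polynomials in [n] variables *)

Section AlgebraicDependence.
Variable K : fieldType.

Lemma msize_mul_leq n (p q : {mpoly K[n]}) a b :
  (msize p <= a.+1)%N -> (msize q <= b.+1)%N -> (msize (p * q) <= (a + b).+1)%N.
Proof.
have [->|pn0] := eqVneq p 0; first by rewrite mul0r msize0.
have [->|qn0] := eqVneq q 0; first by rewrite mulr0 msize0.
by rewrite msizeM //; move: (msize p) (msize q) => x y; lia.
Qed.

Lemma msize_exp_leq n (p : {mpoly K[n]}) a k :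
  (msize p <= a.+1)%N -> (msize (p ^+ k) <= (k * a).+1)%N.
Proof.
move=> pa; elim: k => [|k IH]; first by rewrite expr0 msize1.
by rewrite exprS mulSn; apply: msize_mul_leq.
Qed.

(* There are N^(n+1) monomials of exponents < N in the n+1 given polynomials,
   living in a space of dimension O(N^n). *)
Lemma mpoly_dependence n (lq : n.+1.-tuple {mpoly K[n]}) :
  exists2 G : {mpoly K[n.+1]}, G != 0 & G \mPo lq = 0.
Proof.
pose D := (\max_(i < n.+1) msize (tnth lq i))%N.
(* Products with exponents below [N] involve only monomials with exponents below [c * N], and
   [N = c ^ n + 1] makes [(c * N) ^ n < N ^ n.+1]. *)
pose c := (n.+1 * D).+1; pose N := (c ^ n).+1.
pose I := {ffun 'I_n.+1 -> 'I_N}; pose J := {ffun 'I_n -> 'I_(c * N)}.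
pose mI (f : I) : 'X_{1..n.+1} := [multinom nat_of_ord (f i) | i < n.+1].
pose mJ (f : J) : 'X_{1..n} := [multinom nat_of_ord (f i) | i < n].
pose M : 'M[K]_(#|I|, #|J|) :=
  \matrix_(a, b) ('X_[mI (enum_val a)] \mPo lq)@_(mJ (enum_val b)).
have ltIJ : (#|J| < #|I|)%N.
  rewrite !card_ffun !card_ord expnMn expnS.
  by rewrite ltn_pmul2r ?expn_gt0 //.
(* There are more rows than columns; a nonzero row vector killing [M] supplies the coefficients of
   the relation. *)
have kn0 : kermx M != 0.
  rewrite -mxrank_eq0 mxrank_ker subn_eq0 -ltnNge.
  exact: leq_ltn_trans (rank_leq_col M) ltIJ.
have [a0 ra0] : exists a, row a (kermx M) != 0.
  apply: NNPP => none; case/eqP: kn0; apply/row_matrixP => a; rewrite row0.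
  by apply/eqP/negPn/negP => h; apply: none; exists a.
set u := row a0 (kermx M) in ra0.
have uM : u *m M = 0 by rewrite /u -row_mul mulmx_ker row0.
pose G : {mpoly K[n.+1]} := \sum_a u 0 a *: 'X_[mI (enum_val a)].
exists G.
  case/rV0Pn: ra0 => a ua; apply: contraNneq ua => /mpolyP/(_ (mI (enum_val a))).
  rewrite raddf_sum mcoeff0 (bigD1 a) //= big1 ?addr0 => [|b ba].
    by rewrite mcoeffZ mcoeffX eqxx mulr1 => ->.
  rewrite mcoeffZ mcoeffX; case: eqP => [e|]; rewrite ?mulr0 //.
  case/eqP: ba; apply: enum_val_inj; apply/ffunP => i; apply: val_inj.
  by have /mnmP/(_ i) := e; rewrite !mnmE.
have GE : G \mPo lq = \sum_a u 0 a *: ('X_[mI (enum_val a)] \mPo lq).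
  by rewrite raddf_sum; apply: eq_bigr => a _; rewrite /= comp_mpolyZ.
apply/mpolyP => m; rewrite mcoeff0 GE raddf_sum /=.
have [lt|] := boolP [forall i, m i < c * N]%N.
  pose f : J := [ffun i => Ordinal (forallP lt i)].
  have /matrixP/(_ 0 (enum_rank f)) := uM; rewrite mxE [RHS]mxE => e; rewrite -[RHS]e.
  apply: eq_bigr => a _; rewrite mcoeffZ [M _ _]mxE enum_rankK.
  by congr (_ * _@_ _); apply/mnmP => i; rewrite mnmE ffunE.
rewrite negb_forall => /existsP[i]; rewrite -leqNgt => lei.
apply: big1 => a _; rewrite mcoeffZ memN_msupp_eq0 ?mulr0 //.
apply: msize_mdeg_ge; apply: leq_trans (leq_trans lei _); last first.
  by rewrite mdegE (bigD1 i) //= leq_addr.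
rewrite comp_mpolyX -big_enum /=.
have prodle (r : seq 'I_n.+1) : (msize (\prod_(j <- r) tnth lq j ^+ mI (enum_val a) j)
     <= (size r * (N.-1 * D)).+1)%N.
  elim: r => [|j r IH]; first by rewrite big_nil msize1.
  rewrite big_cons /= mulSn; apply: msize_mul_leq => //.
  apply: leq_trans (msize_exp_leq (a := D) _ _) _.
    by apply: leq_trans (leqnSn _); apply: leq_bigmax.
  by rewrite ltnS leq_mul2r mnmE -ltnS (ltn_ord (enum_val a j)) orbT.
apply: leq_trans (prodle _) _; rewrite size_enum_ord /c /N /=.
by nia.
Qed.

End AlgebraicDependence.

(** * Jacobian pairs *)

Lemma factorial_rmorph_prime (R S : idomainType) (f : {rmorphism R -> S}) a :
  factorial_ring R -> a != 0 -> f a = 0 -> exists2 p, prime_elt p & f p = 0.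
Proof.
move=> fR; move: a; apply: (factorial_ind fR) => [u uu fu0|p a pp _ IH].
  by have := rmorph_unit f uu; rewrite fu0 unitr0.
by rewrite rmorphM => /eqP; rewrite mulf_eq0 => /orP[/eqP fp0|/eqP /IH //]; exists p.
Qed.

Lemma det2_kernel (R : idomainType) (a b p0 p1 q0 q1 : R) :
  p0 * q1 - p1 * q0 != 0 -> a * p0 + b * q0 = 0 -> a * p1 + b * q1 = 0 ->
  a = 0 /\ b = 0.
Proof.
move=> det e0 e1; split; apply: (mulIf det); rewrite mul0r.
  transitivity ((a * p0 + b * q0) * q1 - (a * p1 + b * q1) * q0); first by ring.
  by rewrite e0 e1 !mul0r subr0.
transitivity ((a * p1 + b * q1) * p0 - (a * p0 + b * q0) * p1); first by ring.
by rewrite e0 e1 !mul0r subr0.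
Qed.

Lemma big_ord2 (V : nmodType) (F : 'I_2 -> V) : \sum_(i < 2) F i = F X0 + F X1.
Proof.
rewrite 2!big_ord_recl big_ord0 addr0.
by congr (F _ + F _); apply: val_inj.
Qed.

Lemma forall_ord2 (T : 'I_2 -> Prop) : T X0 -> T X1 -> forall i, T i.
Proof.
move=> T0 T1 [[|[|//]] lt].
  by have -> : Ordinal lt = X0 by apply: val_inj.
by have -> : Ordinal lt = X1 by apply: val_inj.
Qed.

Lemma mwiden_comp_mpoly (R : comNzRingType) k (p q r : {mpoly R[k]})
    (w : {mpoly R[2]}) :
  mwiden w \mPo [tuple p; q; r] = w \mPo [tuple p; q].
Proof.
apply: (@mpoly_rmorph_eq _ _ _ (comp_mpoly [tuple p; q; r] \o @mwiden 2 R)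
  (comp_mpoly [tuple p; q])) => [c|i] /=.
  by rewrite mwidenC !comp_mpolyC.
rewrite mwidenX_widen !comp_mpolyX_tnth.
by elim/forall_ord2: i.
Qed.

Lemma comp_mpoly2_id (R : comNzRingType) (w : {mpoly R[2]}) :
  w \mPo [tuple 'X_X0; 'X_X1] = w.
Proof.
rewrite -[RHS]comp_mpoly_id; congr (_ \mPo _); apply: eq_from_tnth.
by apply: forall_ord2; rewrite tnth_mktuple.
Qed.

Section JacobianPair.
Variables (K : closedFieldType) (P Q : {mpoly K[2]}) (c : K).
Hypotheses (charK0 : [pchar K] =i pred0) (hc : c != 0).
Hypothesis hjac : jac2 P Q = c%:MP.

Lemma jac2_independent (a b : {mpoly K[2]}) :
  (forall i, a * P^`M(i) + b * Q^`M(i) = 0) -> a = 0 /\ b = 0.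
Proof.
move=> h; apply: (det2_kernel _ (h X0) (h X1)).
by rewrite -/(jac2 P Q) hjac mpolyC_eq0.
Qed.

(** Descent on degree: by the chain rule and the nonzero Jacobian, the partial derivatives of a
    relation are relations. They are smaller, hence zero, and in characteristic zero [w] is
    constant. *)
Lemma jac2_comp_eq0 (w : {mpoly K[2]}) : w \mPo [tuple P; Q] = 0 -> w = 0.
Proof.
have [n] := ubnP (msize w); elim: n w => // n IH w lt w0.
apply/eqP/negPn/negP => wn0.
have [dw0 dw1] : w^`M(X0) \mPo [tuple P; Q] = 0 /\ w^`M(X1) \mPo [tuple P; Q] = 0.
  apply: jac2_independent => i.
  have := mderiv_comp_mpoly [tuple P; Q] w i.
  by rewrite w0 mderiv0 big_ord2 => /esym.
have dw i : w^`M(i) = 0.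
  apply: IH; first by apply: leq_trans (msize_mderiv_lt i wn0) _; rewrite -ltnS.
  by elim/forall_ord2: i.
move: w0 wn0; rewrite (mderiv_all_eq0 charK0 dw) comp_mpolyC => ->.
by rewrite eqxx.
Qed.

(** For a relation [H], the chain rule and the Jacobian make the whole gradient at [v] vanish once
    its last component does; hence smoothness is phrased with the last derivative only. *)
Lemma smooth_mem_subalg (z : {mpoly K[2]}) :
  (forall v, exists H : {mpoly K[3]}, H \mPo [tuple P; Q; z] = 0 /\
     (H^`M(ord_max) \mPo [tuple P; Q; z]).@[v] != 0) ->
  exists w : {mpoly K[2]}, z = w \mPo [tuple P; Q].
Proof.
set ev := comp_mpoly _ => smooth.
have evM a b : ev (a * b) = ev a * ev b by apply: rmorphM.
have evD a b : ev (a + b) = ev a + ev b by apply: rmorphD.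
have evB a b : ev (a - b) = ev a - ev b by apply: rmorphB.
have [G Gn0 G0] := mpoly_dependence [tuple P; Q; z].
have [h hP h0] := factorial_rmorph_prime (f := ev) (@factorial_mpoly K 3) Gn0 G0.
have {}h0 : ev h = 0 := h0; have [hn0 hnu _] := hP.
(* [h] generates the kernel: otherwise eliminating the last variable between [h] and [H] would give
   a nonzero relation between [P] and [Q]. *)
have kerP H : ev H = 0 -> divides h H.
  move=> H0; apply: NNPP => /(prime_mpoly_resultant hP)[d [u [v [dn0 ed]]]].
  case/eqP: dn0; apply: jac2_comp_eq0.
  rewrite -(mwiden_comp_mpoly P Q z) ed -/ev.
  by rewrite evD !evM h0 H0 !mulr0 addr0.
have [v|e en0 he] := @mpoly_no_zero_const K 2 (ev h^`M(ord_max)).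
  have [H [/kerP[k ->]]] := smooth v; rewrite -/ev.
  rewrite mderivM evD !evM h0 mulr0 add0r mevalM.
  by apply: contraNneq => ->; rewrite mulr0.
have dh : h^`M(ord_max) = e%:MP.
  have [k hk] : divides h (h^`M(ord_max) - e%:MP).
    by apply: kerP; rewrite evB he /ev comp_mpolyC subrr.
  have [k0|kn0] := eqVneq k 0.
    by apply/eqP; rewrite -subr_eq0 hk k0 mul0r.
  have sh : (1 < msize h)%N.
    rewrite ltnNge; apply: contra hnu => /msize1_polyC eh.
    move: hn0; rewrite eh mpolyC_eq0 => hn0.
    by apply: rmorph_unit; rewrite unitfE.
  have := msizeD_le h^`M(ord_max) (- e%:MP); rewrite hk msizeM // msizeN msizeC en0.
  move: (msize_mderiv_lt ord_max hn0) kn0 sh; rewrite -msize_poly_eq0.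
  move: (msize h) (msize k) (msize _) => a b d; lia.
(* [q] does not involve the last variable, so that variable may be set to [0], and the relation [h]
   reads [e z = - q(P, Q, 0)]. *)
pose q := h - e *: 'X_ord_max.
have dq : q^`M(ord_max) = 0.
  by rewrite mderivB dh mderivZ mderivXU eqxx alg_mpolyC subrr.
have qE : ev q = (q \mPo [tuple 'X_X0; 'X_X1; 0]) \mPo [tuple P; Q].
  rewrite comp_mpoly_comp /ev !comp_mpolyEX; apply: eq_big_seq => m mq.
  congr (_ *: _); rewrite !comp_mpolyX; apply: eq_bigr => i _.
  rewrite tnth_mktuple; case: (ord_lastP i) => [->|[j ->]].
    by rewrite (mderiv_eq0_msupp charK0 dq mq) !expr0.
  congr (_ ^+ _); elim/forall_ord2: j.
    exact/esym/(comp_mpolyX_tnth [tuple P; Q] X0).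
  exact/esym/(comp_mpolyX_tnth [tuple P; Q] X1).
exists ((- e^-1) *: (q \mPo [tuple 'X_X0; 'X_X1; 0])).
rewrite comp_mpolyZ -qE /q evB h0 sub0r /ev comp_mpolyZ.
by rewrite comp_mpolyX_tnth scaleNr scalerN opprK scalerA mulVf // scale1r.
Qed.

Lemma jac2_bijective :
  (exists w : {mpoly K[2]}, 'X_X0 + 'X_X1 = w \mPo [tuple P; Q]) ->
  bijective (endo2 P Q).
Proof.
case=> w hw.
have [|u hu] := smooth_mem_subalg (z := 'X_X0).
  move=> v.
  (* [lr] writes [x] as [t] and [y] as [w(p, q) - t], lifting every polynomial in [x, y] to
     [K[p, q, t]]. *)
  pose lr : 2.-tuple {mpoly K[3]} := [tuple 'X_ord_max; mwiden w - 'X_ord_max].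
  pose l3 := [tuple P; Q; 'X_X0 : {mpoly K[2]}].
  have lrE F : (F \mPo lr) \mPo l3 = F.
    rewrite comp_mpoly_comp -[RHS]comp_mpoly2_id; congr (_ \mPo _).
    apply: eq_from_tnth; apply: forall_ord2; rewrite tnth_mktuple.
      by rewrite comp_mpolyX_tnth.
    rewrite /= [LHS]rmorphB /= mwiden_comp_mpoly -hw comp_mpolyX_tnth.
    by rewrite addrC addKr.
  (* With [F] equal to [P] or [Q], the relation [p - F(t, w - t)] or [q - F(t, w - t)] has
     [t]-derivative [F_y - F_x]. *)
  have witness (F : {mpoly K[2]}) (i : 'I_2) : tnth [tuple P; Q] i = F ->
      (F^`M(X0) - F^`M(X1)).@[v] != 0 ->
      exists H : {mpoly K[3]}, H \mPo l3 = 0 /\ (H^`M(ord_max) \mPo l3).@[v] != 0.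
    move=> hF dF; exists (mwiden 'X_i - (F \mPo lr)); split.
      rewrite [LHS]rmorphB /= mwiden_comp_mpoly comp_mpolyX_tnth hF.
      by rewrite lrE subrr.
    rewrite mderivB mderiv_mwiden sub0r mderiv_comp_mpoly big_ord2 /= mderivB.
    rewrite mderiv_mwiden mderivXU eqxx sub0r mulrN !mulr1.
    by rewrite [X in meval _ X]rmorphN [X in - X]rmorphB /= !lrE mevalN oppr_eq0.
  have [dP|dP] := eqVneq (P^`M(X0) - P^`M(X1)).@[v] 0; last exact: (witness P X0).
  have [dQ|dQ] := eqVneq (Q^`M(X0) - Q^`M(X1)).@[v] 0; last exact: (witness Q X1).
  (* Both differences vanish at [v], so the two columns of the Jacobian matrix coincide there. *)
  case/eqP: hc; rewrite -(mevalC v c) -hjac /jac2.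
  transitivity (P^`M(X0).@[v] * - (Q^`M(X0) - Q^`M(X1)).@[v]
    + Q^`M(X0).@[v] * (P^`M(X0) - P^`M(X1)).@[v]).
    by rewrite !mevalB !mevalM; ring.
  by rewrite dP dQ oppr0 !mulr0 addr0.
pose g (h : {mpoly K[2]}) := h \mPo [tuple u; w - u].
have gK : cancel g (endo2 P Q).
  move=> h; rewrite /endo2 /g comp_mpoly_comp -[RHS]comp_mpoly2_id.
  congr (_ \mPo _); apply: eq_from_tnth; apply: forall_ord2; rewrite tnth_mktuple.
    exact: esym hu.
  by rewrite /= [LHS]rmorphB /= -hu -hw addrC addKr.
(* The other composite follows because [endo2 P Q] has zero kernel. *)
exists g => // h; apply/eqP; rewrite -subr_eq0; apply/eqP/jac2_comp_eq0.
by rewrite comp_mpolyB -/(endo2 P Q _) gK subrr.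
Qed.

End JacobianPair.

(** * Krull and embedding dimension of localizations at points *)

Section Subalgebra.
Variables (K : fieldType) (k : nat) (A : {mpoly K[k]} -> Prop).

Definition subalgebra :=
  [/\ forall c, A c%:MP, forall a b, A a -> A b -> A (a + b) &
      forall a b, A a -> A b -> A (a * b)].

Hypothesis subA : subalgebra.

Lemma subalg_ideal_sub I a b : ideal_of A I -> I a -> I b -> I (a - b).
Proof.
have [AC _ _] := subA; case=> _ _ ID IM Ia Ib; apply: ID => //.
by rewrite -mulN1r; apply: IM => //; rewrite -mpolyC1 -mpolyCN.
Qed.

Lemma subalg_mmap n (h : 'I_n -> {mpoly K[k]}) G :
  (forall i, A (h i)) -> A (mmap (@mpolyC k K) h G).
Proof.
have [AC AD AM] := subA => Ah; elim/mpoly_ring_ind: G => [c|i|p q Ap Aq|p q Ap Aq].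
- by rewrite mmapC; apply: AC.
- by rewrite mmapX mmap1U.
- by rewrite mmapD; apply: AD.
- by rewrite rmorphM; apply: AM.
Qed.

(* Lowest terms: if [a 0] is in [c 1] but not in [c 0], then a polynomial in
   [a 0] lying in [c 0] has its lowest nonzero coefficient in [c 1]. *)
Lemma prime_chain_independent n c (a : nat -> {mpoly K[k]}) (G : {mpoly K[n]}) :
    (forall i, (i <= n)%N -> prime_ideal A (c i)) ->
    (forall i x, (i < n)%N -> c i x -> c i.+1 x) ->
    (forall i, (i < n)%N -> c i.+1 (a i) /\ ~ c i (a i)) ->
  G != 0 -> ~ c 0%N (mmap (@mpolyC k K) (fun i : 'I_n => a (n.-1 - i)%N) G).
Proof.
have [AC AD AM] := subA.
elim: n c a G => [|n IH] c a G cP cS ca Gn0.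
  have [[[_ _ _ cM] [x [Ax ncx]]] _] := cP 0%N isT.
  move: Gn0; rewrite (mpoly0_polyC G) mpolyC_eq0 mmapC => gn0 c0; apply: ncx.
  have -> : x = x * ((G@_0)^-1)%:MP * (G@_0)%:MP.
    by rewrite -mulrA -mpolyCM mulVf // mpolyC1 mulr1.
  by apply: cM => //; apply: AM.
have [[[c0A c00 c0D c0M] _] c0P] := cP 0%N isT.
have [c1I _] := (cP 1%N isT).1; have [_ _ _ c1M] := c1I.
have [c1a c0a] := ca 0%N isT.
(* The reversed indexing makes [a 0] the last variable, the one that [muni] singles out; [val]
   evaluates the coefficients at [a 1, ..., a n]. *)
pose val := mmap (@mpolyC k K) (fun i : 'I_n => a (n.-1 - i).+1).
have aA i : (i < n.+1)%N -> A (a i).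
  by move=> lt; have [/(_ _ (proj1 (ca i lt)))] := (cP i.+1 lt).1.1.
have valA g : A (val g) by apply: subalg_mmap => i; apply: aA; case: i => i /=; lia.
have nval g : g != 0 -> ~ c 1%N (val g).
  by apply: (IH (fun i => c i.+1) (fun i => a i.+1)) => i *;
     [apply: cP | apply: cS | apply: ca].
have valMXaddC f g : (map_poly val (f * 'X + g%:P)).[a 0%N]
    = (map_poly val f).[a 0%N] * a 0%N + val g.
  by rewrite rmorphD rmorphM /= map_polyX map_polyC hornerMXaddC.
have valP f : A (map_poly val f).[a 0%N].
  elim/poly_ind: f => [|f g IHf]; first by rewrite rmorph0 horner0 -mpolyC0.
  by rewrite valMXaddC; apply: AD => //; apply: AM => //; apply: aA.
suff main (f : {poly {mpoly K[n]}}) : f != 0 ->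
    ~ c 0%N (map_poly val f).[a 0%N].
  have -> : mmap (@mpolyC k K) (fun i : 'I_n.+1 => a (n - i)%N) G
      = (map_poly val (muni G)).[a 0%N].
    apply: (@mpoly_rmorph_eq _ _ _ (mmap (@mpolyC k K) _)
      (horner_eval (a 0%N) \o map_poly val \o @muni n K)) => [e|i] /=.
      by rewrite mmapC muniC map_polyC /= /val mmapC /horner_eval hornerC.
    rewrite mmapX mmap1U; case: (ord_lastP i) => [->|[j ->]].
      by rewrite muniX_max map_polyX /horner_eval hornerX subnn.
    rewrite muniX_widen map_polyC /= /val mmapX mmap1U /horner_eval hornerC.
    by congr (a _); case: j => j /=; lia.
  apply: main; apply: contraNneq Gn0 => e.
  by rewrite -(muniK G) e rmorph0.
(* For [f * 'X + g]: if [g] is nonzero, its value would lie in [c 1], against the induction on [n];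
   if [g = 0], the factor [a 0], outside the prime [c 0], cancels. *)
elim/poly_ind: f => [|f g IHf fn0]; first by rewrite eqxx.
rewrite valMXaddC => c0v.
have [g0|gn0] := eqVneq g 0; last first.
  apply: (nval g gn0).
  have -> : val g = ((map_poly val f).[a 0%N] * a 0%N + val g)
     - (map_poly val f).[a 0%N] * a 0%N by rewrite addrC addKr.
  by apply: subalg_ideal_sub => //; [apply: cS | apply: c1M].
have val0 : val 0 = 0 by apply: raddf0.
move: fn0 c0v; rewrite g0 polyC0 val0 !addr0 => fn0 c0v.
have [||/IHf|//] := c0P _ _ _ _ c0v; [exact: valP | exact: aA | apply].
by apply: contraNneq fn0 => ->; rewrite mul0r.
Qed.

(** Contracted to [A], a chain longer than [k] gives [k.+1] elements independent modulo its bottom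
    prime, yet any [k.+1] polynomials in [k] variables are dependent. *)
Lemma localization_dim_le p d c : prime_ideal A p ->
  prime_chain (localization A p) d c -> (d <= k)%N.
Proof.
have [AC AD AM] := subA => -[[[pA p0 pD pM] [x0 [Ax0 npx0]]] pP] [cP cS].
rewrite leqNgt; apply/negP => ltkd.
have A1 : A 1 by rewrite -mpolyC1.
have np1 : ~ p 1 by move=> p1; apply: npx0; rewrite -[x0]mulr1; apply: pM.
have locA b : A b -> localization A p (tofrac b).
  by move=> Ab; exists b, 1; split=> //; rewrite rmorph1 divr1.
pose c' i b := A b /\ c i (tofrac b).
have c'P i : (i <= d)%N -> prime_ideal A (c' i).
  move=> /cP[[[cA c0 cD cM] [y [Ly ncy]]] cPr]; split; [split; [split|]|].
  - by move=> b [].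
  - by split; [rewrite -mpolyC0 | rewrite rmorph0].
  - move=> a b [Aa ca] [Ab cb]; split; first exact: AD.
    by rewrite rmorphD; apply: cD.
  - move=> a b Aa [Ab cb]; split; first exact: AM.
    by rewrite rmorphM; apply: cM => //; apply: locA.
  - exists 1; split=> // -[_]; rewrite rmorph1 => c1; apply: ncy.
    by rewrite -[y]mulr1; apply: cM.
  - move=> a b Aa Ab [_]; rewrite rmorphM => cab.
    by have [] := cPr _ _ (locA _ Aa) (locA _ Ab) cab; [left | right].
have ex (i : 'I_d) : exists a, c' i.+1 a /\ ~ c' i a.
  have [_ [y [c1y c0y]]] := cS i (ltn_ord i).
  have [[[c1A _ _ c1M] _] _] := cP i.+1 (ltn_ord i).
  have [[[_ _ _ c0M] _] _] := cP i (ltnW (ltn_ord i)).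
  have [a [s [Aa As nps ey]]] := c1A _ c1y.
  have sn0 : tofrac s != 0 :> {fraction {mpoly K[k]}}.
    by rewrite tofrac_eq0; apply/eqP => s0; apply: nps; rewrite s0.
  (* The numerator [a] and the fraction [y] are associated in the localization, so [a] separates the
     same two primes. *)
  exists a; split.
    split=> //; have -> : tofrac a = tofrac s * y by rewrite ey mulrC divfK.
    by apply: c1M => //; apply: locA.
  case=> _ c0a; apply: c0y; rewrite ey mulrC; apply: c0M => //.
  by exists 1, s; split=> //; rewrite rmorph1 mul1r.
have [a aP] := fin_all_exists ex.
(* The default [0] is never reached: only indices up to [k < d] are used. *)
pose a' i := if insub i is Some j then a j else 0.
have a'P i : (i < k.+1)%N -> c' i.+1 (a' i) /\ ~ c' i (a' i).
  move=> lt; have ltd : (i < d)%N by apply: leq_trans lt ltkd.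
  by rewrite /a' insubT; apply: (aP (Ordinal ltd)).
have [G Gn0 G0] := mpoly_dependence [tuple a' (k - i)%N | i < k.+1].
have := @prime_chain_independent k.+1 c' a' G.
case=> //.
- by move=> i le; apply: c'P; apply: leq_trans le ltkd.
- move=> i b lt [Ab cb]; split=> //; apply: (proj1 (cS i _)) => //.
  exact: leq_trans lt ltkd.
have -> : mmap (@mpolyC k K) (fun i : 'I_k.+1 => a' (k.+1.-1 - i)%N) G = 0.
  rewrite -G0; apply: (@mpoly_rmorph_eq _ _ _ (mmap (@mpolyC k K) _)
    (comp_mpoly _)) => [e|i] /=; first by rewrite mmapC comp_mpolyC.
  by rewrite mmapX mmap1U comp_mpolyX_tnth tnth_mktuple.
by have [[[]]] := c'P 0%N isT.
Qed.

End Subalgebra.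

(** * Maximal ideal and differentials at a point coming from the plane or an affine space *)

Section PointLocalization.
Variables (K : fieldType) (n k : nat) (lq : n.-tuple {mpoly K[k]}) (v : 'I_k -> K).

(** For [lq = [tuple P; Q; 'X_X0 + 'X_X1]] this unfolds to [subalg_PQxy P Q]. *)
Definition gen_subalg b := exists g : {mpoly K[n]}, b = g \mPo lq.

Definition point_ideal b := gen_subalg b /\ b.@[v] = 0.

Local Notation S := gen_subalg.
Local Notation "x %:F" := (@tofrac {mpoly K[k]} x).

Lemma gen_subalgP : subalgebra S.
Proof.
split=> [c|_ _ [g ->] [h ->]|_ _ [g ->] [h ->]].
- by exists c%:MP; rewrite comp_mpolyC.
- by exists (g + h); rewrite comp_mpolyD.
- by exists (g * h); rewrite rmorphM.
Qed.

Lemma point_ideal_prime : prime_ideal S point_ideal.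
Proof.
have [SC SD SM] := gen_subalgP.
split; [split; [split|]|].
- by move=> b [].
- by split; [rewrite -mpolyC0 | rewrite meval0].
- move=> a b [Sa a0] [Sb b0]; split; first exact: SD.
  by rewrite mevalD a0 b0 addr0.
- move=> a b Sa [Sb b0]; split; first exact: SM.
  by rewrite mevalM b0 mulr0.
- exists 1; split; first by rewrite -mpolyC1.
  by case=> _ /eqP; rewrite meval1 oner_eq0.
- move=> a b Sa Sb [_ /eqP]; rewrite mevalM mulf_eq0.
  by case/orP=> /eqP ?; [left | right].
Qed.

Local Notation L := (localization S point_ideal).

Definition local_point_ideal z :=
  exists a s, [/\ S a, S s, a.@[v] = 0, s.@[v] != 0 & z = a%:F / s%:F].

Lemma point_localizationP z :
  L z <-> exists a s, [/\ S a, S s, s.@[v] != 0 & z = a%:F / s%:F].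
Proof.
split=> -[a [s [Sa Ss sv ->]]]; exists a, s; split=> //.
  by apply/eqP => s0; apply: sv.
by case=> _ s0; case/eqP: sv.
Qed.

Lemma point_denom_neq0 (s : {mpoly K[k]}) : s.@[v] != 0 -> s%:F != 0.
Proof. by rewrite tofrac_eq0; apply: contraNneq => ->; rewrite meval0. Qed.

(** A fraction of [L] outside the ideal has a numerator nonzero at [v], hence is invertible in [L],
    and no proper ideal contains it. *)
Lemma local_point_ideal_maximal : maximal_ideal L local_point_ideal.
Proof.
have [SC SD SM] := gen_subalgP.
have S1 : S 1 by rewrite -mpolyC1.
split; [split; [split|]|].
- by move=> _ [a [s [Sa Ss _ sv ->]]]; apply/point_localizationP; exists a, s.
- exists 0, 1; split; rewrite ?meval0 ?meval1 ?oner_neq0 ?rmorph0 ?mul0r //.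
  by rewrite -mpolyC0.
- move=> _ _ [a [s [Sa Ss av sv ->]]] [b [t [Sb St bv tv ->]]].
  exists (a * t + b * s), (s * t); split.
  + by apply: SD; apply: SM.
  + exact: SM.
  + by rewrite mevalD !mevalM av bv !mul0r addr0.
  + by rewrite mevalM mulf_neq0.
  + by rewrite addf_div ?point_denom_neq0 // rmorphD !rmorphM.
- move=> _ _ /point_localizationP[a [s [Sa Ss sv ->]]] [b [t [Sb St bv tv ->]]].
  exists (a * b), (s * t); split; rewrite ?mevalM ?bv ?mulr0 ?mulf_neq0 //.
  + exact: SM.
  + exact: SM.
  + by rewrite mulf_div !rmorphM.
- exists 1; split.
    apply/point_localizationP; exists 1, 1.
    by split; rewrite ?meval1 ?oner_neq0 ?rmorph1 ?divr1.
  case=> a [s [_ _ av sv e]].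
  have : a%:F = s%:F by rewrite -[RHS]mul1r e divfK ?point_denom_neq0.
  by move/eqP; rewrite tofrac_eq => /eqP eas; rewrite -eas av eqxx in sv.
move=> J [[JL J0 JD JM] [y [Ly nJy]]] sub x; split; last exact: sub.
move=> Jx; have /point_localizationP[a [s [Sa Ss sv ex]]] := JL _ Jx.
have [av|av] := eqVneq a.@[v] 0; first by exists a, s.
case: nJy; have -> : y = y * (s%:F / a%:F) * x.
  rewrite ex -mulrA mulf_div mulrC [a%:F * _]mulrC divff ?mul1r //.
  by rewrite mulf_neq0 ?point_denom_neq0.
apply: JM => //; move/point_localizationP: Ly => [b [t [Sb St tv ->]]].
apply/point_localizationP; exists (b * s), (t * a).
split; rewrite ?mevalM ?mulf_neq0 ?mulf_div ?rmorphM //; exact: SM.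
Qed.

Local Notation z0 := (fun i => (tnth lq i).@[v]).

(* The differential at the point of an element of the local maximal ideal,
   computed on a fraction of lifts to the polynomial ring. *)
Definition local_differential z (d : 'rV[K]_n) :=
  exists a s : {mpoly K[n]}, [/\ a.@[z0] = 0, s.@[z0] != 0,
    z = (a \mPo lq)%:F / (s \mPo lq)%:F &
    d = \row_i (a^`M(i).@[z0] / s.@[z0])].

Hypothesis singular : forall H : {mpoly K[n]}, H \mPo lq = 0 ->
  forall i, (H^`M(i) \mPo lq).@[v] = 0.

Lemma comp_denom_neq0 (s : {mpoly K[n]}) : s.@[z0] != 0 -> (s \mPo lq)%:F != 0.
Proof. by move=> s0; apply: point_denom_neq0; rewrite comp_mpoly_meval. Qed.

(** Two lifts of one fraction differ by the relation [a * t - b * s], whose gradient vanishes at the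
    point by [singular]. *)
Lemma local_differential_uniq z d e :
  local_differential z d -> local_differential z e -> d = e.
Proof.
case=> a [s [av sv -> ->]] [b [t [bv tv eab ->]]].
apply/rowP => i; rewrite !mxE.
have : (a * t - b * s) \mPo lq = 0.
  apply/eqP; rewrite comp_mpolyB subr_eq0 -tofrac_eq !rmorphM /=.
  by move/eqP: eab; rewrite eqr_div ?comp_denom_neq0.
move/singular/(_ i); rewrite comp_mpoly_meval mderivB !mderivM.
rewrite mevalB !mevalD !mevalM av bv !mul0r !addr0 => /eqP.
by rewrite subr_eq0 -eqr_div // => /eqP.
Qed.

Lemma local_differentialD z1 z2 d1 d2 :
  local_differential z1 d1 -> local_differential z2 d2 ->
  local_differential (z1 + z2) (d1 + d2).
Proof.
case=> a [s [av sv -> ->]] [b [t [bv tv -> ->]]].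
exists (a * t + b * s), (s * t); split.
- by rewrite mevalD !mevalM av bv !mul0r addr0.
- by rewrite mevalM mulf_neq0.
- by rewrite addf_div ?comp_denom_neq0 // comp_mpolyD !rmorphM /= rmorphD !rmorphM.
apply/rowP => i; rewrite !mxE mderivD !mderivM !mevalD !mevalM av bv.
by rewrite !mul0r !addr0 addf_div.
Qed.

(** Leibniz rule: [z] vanishes at the point, so [x] contributes only its value there, which is
    [e]. *)
Lemma local_differentialM x z d : L x -> local_differential z d ->
  exists e : K, local_differential (x * z) (e *: d).
Proof.
case/point_localizationP=> _ [_ [[b ->] [t ->] tv ->]] [a [s [av sv -> ->]]].
rewrite comp_mpoly_meval in tv.
exists (b.@[z0] / t.@[z0]), (b * a), (t * s); split.
- by rewrite mevalM av mulr0.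
- by rewrite mevalM mulf_neq0.
- by rewrite mulf_div !rmorphM.
apply/rowP => i; rewrite !mxE mderivM mevalD !mevalM av mulr0 add0r.
by rewrite mulf_div.
Qed.

(** The differentials of the generators span those of the whole ideal, and the coordinate functions
    centred at the point realize the standard basis; so the [m] differentials have rank [n]. *)
Lemma local_embedding_dim m (g : 'I_m -> {fraction {mpoly K[k]}}) :
  ideal_generated_by L local_point_ideal g -> (n <= m)%N.
Proof.
have [SC SD SM] := gen_subalgP => -[gL gP].
have L0 : L 0.
  apply/point_localizationP; exists 0, 1; split; rewrite ?meval1 ?oner_neq0 //.
  - by rewrite -mpolyC0.
  - by rewrite -mpolyC1.
  - by rewrite rmorph0 mul0r.
have L1 : L 1.
  apply/point_localizationP; exists 1, 1; split; rewrite ?meval1 ?oner_neq0 //.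
  1,2: by rewrite -mpolyC1.
  by rewrite rmorph1 divr1.
have dg j : exists d, local_differential (g j) d.
  have /gP : exists c : 'I_m -> _, (forall i, L (c i)) /\ g j = \sum_i c i * g i.
    exists (fun i => (i == j)%:R); split; first by move=> i; case: (i == j).
    rewrite (bigD1 j) //= eqxx mul1r big1 ?addr0 // => i /negPf->.
    by rewrite mul0r.
  case=> _ [_ [[a ->] [s ->] av sv ->]].
  rewrite comp_mpoly_meval in av; rewrite comp_mpoly_meval in sv.
  by exists (\row_i (a^`M(i).@[z0] / s.@[z0])), a, s.
have [d dP] := fin_all_exists dg.
pose D : 'M[K]_(m, n) := \matrix_j d j.
suff sub1 : (1%:M <= D)%MS.
  by have := mxrankS sub1; rewrite mxrank1 => /leq_trans; apply; apply: rank_leq_row.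
apply/row_subP => i.
pose l : {mpoly K[n]} := 'X_i - (z0 i)%:MP.
have lv : l.@[z0] = 0 by rewrite mevalB mevalXU mevalC subrr.
have dl : local_differential (l \mPo lq)%:F (row i 1%:M).
  exists l, 1; split=> //.
  - by rewrite meval1 oner_neq0.
  - by rewrite comp_mpoly1 rmorph1 divr1.
  apply/rowP => j; rewrite !mxE meval1 divr1 /l mderivB mderivC subr0 mderivXU.
  by rewrite rmorph_nat.
have /gP[c [cL ec]] : local_point_ideal (l \mPo lq)%:F.
  exists (l \mPo lq), 1; split; rewrite ?meval1 ?oner_neq0 ?rmorph1 ?divr1 //.
  - by exists l.
  - by rewrite -mpolyC1.
  - by rewrite comp_mpoly_meval.
have [e eD eP] : exists2 e : 'rV[K]_n, (e <= D)%MS &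
    local_differential (\sum_j c j * g j) e.
  apply: (big_ind (fun z => exists2 e : 'rV[K]_n, (e <= D)%MS & local_differential z e)).
  - exists 0; first exact: sub0mx.
    exists 0, 1; split; rewrite ?meval0 ?meval1 ?oner_neq0 //.
      by rewrite comp_mpoly0 rmorph0 mul0r.
    by apply/rowP => j; rewrite !mxE mderiv0 meval0 mul0r.
  - move=> z1 z2 [e1 e1D e1P] [e2 e2D e2P]; exists (e1 + e2).
      exact: addmx_sub.
    exact: local_differentialD.
  - move=> j _; have [e eP] := local_differentialM (cL j) (dP j).
    exists (e *: d j) => //; apply: scalemx_sub.
    by have := row_sub j D; rewrite rowK.
by rewrite (local_differential_uniq dl (z := _) (e := e)) // ec.
Qed.

End PointLocalization.

(** If every relation were singular at [v], the maximal ideal would need at least [n] generators;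
    regularity equates their least number with the Krull dimension, at most [k < n]. *)
Lemma regular_smooth_point (K : fieldType) n k (lq : n.-tuple {mpoly K[k]}) v :
  (k < n)%N -> regular_ring (gen_subalg lq) ->
  exists H i, H \mPo lq = 0 /\ (H^`M(i) \mPo lq).@[v] != 0.
Proof.
move=> ltkn [_ reg]; apply: NNPP => none.
have singular (H : {mpoly K[n]}) : H \mPo lq = 0 ->
    forall i, (H^`M(i) \mPo lq).@[v] = 0.
  by move=> H0 i; apply/eqP/negPn/negP => h; apply: none; exists H, i.
have pP := point_ideal_prime lq v.
have [_ [m [[_ muniq] [d [[[c chain] _] [[g [gL gP]] _]]]]]] := reg _ pP.
have mE := muniq _ (local_point_ideal_maximal lq v).
have led := localization_dim_le (gen_subalgP lq) pP chain.
have gen : ideal_generated_by (localization (gen_subalg lq) (point_ideal lq v))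
    (local_point_ideal lq v) g.
  by split=> // x; rewrite mE; apply: gP.
by have := local_embedding_dim singular gen; rewrite leqNgt (leq_ltn_trans led).
Qed.

Theorem theorem4p1 (K : closedFieldType) (charK0 : [pchar K] =i pred0)
  (P Q : {mpoly K[2]}) (c : K) (hc : c != 0)
  (hjac : jac2 P Q = c%:MP)
  (hreg : regular_ring (subalg_PQxy P Q)) :
  bijective (endo2 P Q).
Proof.
apply: (jac2_bijective charK0 hc hjac).
apply: (smooth_mem_subalg charK0 hc hjac) => v.
have [H [i [H0 dHi]]] := regular_smooth_point v (isT : (2 < 3)%N) hreg.
exists H; split=> //; apply/eqP => dH2; case/eqP: dHi.
set l3 := [tuple _; _; _] in H0 dH2 *.
pose dH (j : 'I_2) := (H^`M(widen_ord (leqnSn 2) j) \mPo l3).@[v].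
(* With the last derivative zero, the chain rule leaves a linear system in the other two whose
   determinant is the Jacobian [c]. *)
have rel j : dH X0 * P^`M(j).@[v] + dH X1 * Q^`M(j).@[v] = 0.
  have := congr1 (meval v) (mderiv_comp_mpoly l3 H j).
  rewrite H0 mderiv0 meval0 big_ord_recr /= big_ord2 mevalD mevalM dH2 mul0r.
  by rewrite addr0 mevalD !mevalM => /esym.
have [|dH0 dH1] := det2_kernel _ (rel X0) (rel X1).
  by rewrite -!mevalM -mevalB -/(jac2 P Q) hjac mevalC.
case: (ord_lastP i) => [->|[j ->]]; first exact: dH2.
by elim/forall_ord2: j.
Qed.
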